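(* For all natural numbers $n$ of the form $4k+1$ where $k$ is an integer, $$\gamma(Q_{n\times n})\ \ge\ \beta(Q_{n\times n})\ \ge\ (n+1)/2.$$
   Context: Natural numbers are positive integers. The squares (cells) of the $n\times n$ chessboard are $V(Q_{n\times n})=\{(x,y): 0\le x,y\le n-1\}$, with $x$ the column number and $y$ the row number. A column is a set of all cells with a fixed $x$; a row is a set of all cells with a fixed $y$; a sum diagonal is a (nonempty) set of all cells with a fixed value of $x+y$; a difference diagonal is a (nonempty) set of all cells with a fixed value of $x-y$. The Queen's graph $Q_{n\times n}$ has vertex set $V(Q_{n\times n})$, two distinct cells being adjacent if they lie in a common row, column, sum diagonal or difference diagonal. $\gamma(Q_{n\times n})$ is the minimum size of a dominating set of $Q_{n\times n}$, i.e. of a set $\mathcal D$ of cells such that every cell is in $\mathcal D$ or adjacent to an element of $\mathcal D$. $\beta(Q_{n\times n})$ (Relaxed Queen's Domination) is the least number $p$ such that there exist rows $R_0,\dots,R_{p-1}$, columns $C_0,\dots,C_{p-1}$, sum diagonals $S_0,\dots,S_{p-1}$ and difference diagonals $D_0,\dots,D_{p-1}$ (repetitions allowed) with $V(Q_{n\times n})=\bigcup_i R_i\cup\bigcup_i C_i\cup\bigcup_i S_i\cup\bigcup_i D_i$. *)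

(* Defs.v *)
From mathcomp Require Import all_boot all_order all_algebra.

Set Implicit Arguments.
Unset Strict Implicit.
Unset Printing Implicit Defensive.

(* The cell (x, y): x is the column number, y the row number. *)
Notation cell n := ('I_n * 'I_n)%type.

Definition column n (x : nat) : {set cell n} := [set c : cell n | c.1 == x :> nat].
Definition row n (y : nat) : {set cell n} := [set c : cell n | c.2 == y :> nat].
Definition sum_diagonal n (s : nat) : {set cell n} :=
  [set c : cell n | c.1 + c.2 == s :> nat].
Definition diff_diagonal n (d : int) : {set cell n} :=
  [set c : cell n | (c.1%:Z - c.2%:Z == d)%R].

Definition columns n : {set {set cell n}} := [set column n x | x : 'I_n].
Definition rows n : {set {set cell n}} := [set row n y | y : 'I_n].

(* A diagonal is nonempty exactly when its constant is attained at some cell;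
   see sum_diagonalsP and diff_diagonalsP. *)
Definition sum_diagonals n : {set {set cell n}} :=
  [set sum_diagonal n (c.1 + c.2) | c : cell n].
Definition diff_diagonals n : {set {set cell n}} :=
  [set diff_diagonal n (c.1%:Z - c.2%:Z)%R | c : cell n].

Lemma sum_diagonalsP n (L : {set cell n}) :
  reflect (L != set0 /\ exists s, L = sum_diagonal n s)
          (L \in sum_diagonals n).
Proof.
apply: (iffP imsetP) => [[c _ ->]|[/set0Pn[c cL] [s Ls]]].
  by split; [apply/set0Pn; exists c; rewrite inE | eexists].
by exists c => //; move: cL; rewrite Ls inE => /eqP ->.
Qed.

Lemma diff_diagonalsP n (L : {set cell n}) :
  reflect (L != set0 /\ exists d, L = diff_diagonal n d)
          (L \in diff_diagonals n).
Proof.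
apply: (iffP imsetP) => [[c _ ->]|[/set0Pn[c cL] [d Ld]]].
  by split; [apply/set0Pn; exists c; rewrite inE | eexists].
by exists c => //; move: cL; rewrite Ld inE => /eqP ->.
Qed.

Definition queen_adj n (c d : cell n) : bool :=
  (c != d) &&
  [exists L in rows n :|: columns n :|: sum_diagonals n :|: diff_diagonals n,
     (c \in L) && (d \in L)].

Definition dominating n (D : {set cell n}) : bool :=
  [forall c, (c \in D) || [exists d in D, queen_adj c d]].

Definition has_dominating_set n (m : nat) : bool :=
  [exists D : {set cell n}, dominating D && (#|D| == m)].

Lemma ex_dominating_set n : exists m, has_dominating_set n m.
Proof.
exists #|[set: cell n]|; apply/existsP; exists setT; rewrite eqxx andbT.
by apply/forallP => c; rewrite inE.
Qed.

Definition queen_gamma n : nat := ex_minn (ex_dominating_set n).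

Definition line_coverable n (p : nat) : bool :=
  [exists R : {ffun 'I_p -> {set cell n}},
   exists C : {ffun 'I_p -> {set cell n}},
   exists S : {ffun 'I_p -> {set cell n}},
   exists D : {ffun 'I_p -> {set cell n}},
   [&& [forall i, R i \in rows n],
       [forall i, C i \in columns n],
       [forall i, S i \in sum_diagonals n],
       [forall i, D i \in diff_diagonals n] &
       [set: cell n] == (\bigcup_i R i) :|: (\bigcup_i C i)
                          :|: (\bigcup_i S i) :|: (\bigcup_i D i)]].

Lemma ex_line_coverable n : exists p, line_coverable n p.
Proof.
exists n.
apply/existsP; exists [ffun i : 'I_n => row n i].
apply/existsP; exists [ffun i : 'I_n => column n i].
apply/existsP; exists [ffun i : 'I_n => sum_diagonal n (i + i)].
apply/existsP; exists [ffun i : 'I_n => diff_diagonal n (i%:Z - i%:Z)%R].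
apply/and5P; split; try (apply/forallP => i; rewrite ffunE; apply/imsetP).
- by exists i.
- by exists i.
- by exists (i, i).
- by exists (i, i).
rewrite eq_sym -subTset; apply/subsetP => c _; rewrite !inE -!orbA.
by apply/orP; left; apply/bigcupP; exists c.2; rewrite // ffunE inE.
Qed.

Definition queen_beta n : nat := ex_minn (ex_line_coverable n).

(* Main.v *)
Require Import Defs.
From mathcomp Require Import all_boot all_order all_algebra.
From mathcomp Require Import zify.

(** The inequality [queen_beta n <= queen_gamma n] holds because a dominating
    set of size [m] yields a cover by lines: take the four lines through each
    of its cells.

    For the lower bound, let [n = 4k + 1] and suppose that at most [2k] lines of
    each kind cover the board. Then at least [2k + 1] columns and [2k + 1] rows
    are not among the chosen ones; call them free. A cell where a free column
    meets a free row must lie on a chosen diagonal. Let [a], [b] be the extreme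
    free columns and [lo], [hi] the extreme free rows.

    - If [hi - lo < b - a], no diagonal meets both columns [a] and [b] inside
      the strip of rows from [lo] to [hi], so the [4k + 2] or more cells of these
      two columns in free rows need that many diagonals, while at most [4k] are
      available ([column_gap_le]). The case [b - a < hi - lo] is symmetric
      ([row_gap_le]).

    - If [b - a = hi - lo], the box spanned by these four lines is a square. Each
      of its sides, without the corners, has at least [2k - 1] cells in which two
      free lines cross. Sort the chosen diagonals that meet the sides away from
      the corners by direction and by the side of the centre on which they lie:
      each of the four resulting classes consists of diagonals that meet two
      adjacent sides, once each. So the four sides together require [4k - 2]
      diagonals, which leaves two for the corners, and two diagonals cover the
      four corners only if they are the two main diagonals of the box. Hence at
      most [2k - 1] diagonals of each direction remain for the sides, and every
      count is tight. Two classes of different direction share a side and total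
      [2k - 1]; so do the two classes of one direction. Therefore two classes
      that share a side have the same size and [2k - 1] is even, which is absurd
      ([square_box_absurd]). *)

Set Implicit Arguments.
Unset Strict Implicit.
Unset Printing Implicit Defensive.

Import Order.TTheory GRing.Theory Num.Theory.

(** * Domination gives a cover by lines *)

Lemma queen_beta_le_gamma n : queen_beta n <= queen_gamma n.
Proof.
rewrite /queen_gamma; case: ex_minnP => m /existsP[Q /andP[domQ /eqP <-]] _.
rewrite /queen_beta; case: ex_minnP => b _; apply.
apply/existsP; exists [ffun i : 'I_#|Q| => Defs.row n (enum_val i).2].
apply/existsP; exists [ffun i : 'I_#|Q| => column n (enum_val i).1].
apply/existsP; exists [ffun i : 'I_#|Q| =>
  sum_diagonal n ((enum_val i).1 + (enum_val i).2)].
apply/existsP; exists [ffun i : 'I_#|Q| =>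
  diff_diagonal n ((enum_val i).1%:Z - (enum_val i).2%:Z)%R].
apply/and5P; split; try (apply/forallP => i; rewrite ffunE; exact: imset_f).
rewrite eq_sym -subTset; apply/subsetP => c _; rewrite !inE.
have /forallP/(_ c)/orP[cQ|/existsP[q /andP[qQ]]] := domQ.
  do 3 (apply/orP; left); apply/bigcupP; exists (enum_rank_in cQ c) => //.
  by rewrite ffunE enum_rankK_in // inE.
case/andP=> _ /existsP[L /andP[+ /andP[cL qL]]]; rewrite !inE -!orbA.
have qK : enum_val (enum_rank_in qQ q) = q by rewrite enum_rankK_in.
case/or4P=> /imsetP[z _ defL]; move: cL qL;
  rewrite defL !inE => /eqP cz /eqP qz; apply/or4P.
- apply: Or41; apply/bigcupP; exists (enum_rank_in qQ q) => //.
  by rewrite ffunE inE qK cz qz.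
- apply: Or42; apply/bigcupP; exists (enum_rank_in qQ q) => //.
  by rewrite ffunE inE qK cz qz.
- apply: Or43; apply/bigcupP; exists (enum_rank_in qQ q) => //.
  by rewrite ffunE inE qK cz qz.
- apply: Or44; apply/bigcupP; exists (enum_rank_in qQ q) => //.
  by rewrite ffunE inE qK cz qz.
Qed.

(** * Covers as families of coordinates *)

Definition covers n p (r c : 'I_p -> 'I_n) (s t : 'I_p -> int) : Prop :=
  forall x y : 'I_n,
    [\/ exists i, c i = x, exists i, r i = y,
        exists i, (x%:Z + y%:Z)%R = s i | exists i, (x%:Z - y%:Z)%R = t i].

Lemma line_coverable_covers n p :
  line_coverable n p -> exists r c s t, @covers n p r c s t.
Proof.
case/existsP=> R /existsP[C /existsP[S /existsP[D]]].
case/and5P=> /forallP hR /forallP hC /forallP hS /forallP hD /eqP cov.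
have /fin_all_exists[r rE] i : exists y : 'I_n, R i = Defs.row n y.
  by have /imsetP[y _ ->] := hR i; exists y.
have /fin_all_exists[c cE] i : exists x : 'I_n, C i = column n x.
  by have /imsetP[x _ ->] := hC i; exists x.
have /fin_all_exists[s sE] i : exists z : cell n, S i = sum_diagonal n (z.1 + z.2).
  by have /imsetP[z _ ->] := hS i; exists z.
have /fin_all_exists[t tE] i :
    exists z : cell n, D i = diff_diagonal n (z.1%:Z - z.2%:Z)%R.
  by have /imsetP[z _ ->] := hD i; exists z.
exists r, c, (fun i => (((s i).1 + (s i).2)%N%:Z)%R),
  (fun i => ((t i).1%:Z - (t i).2%:Z)%R) => x y.
have : (x, y) \in [set: cell n] by rewrite inE.
rewrite cov !inE -!orbA => /or4P[] /bigcupP[i _].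
- by rewrite rE inE => /eqP/= h; apply: Or42; exists i; apply: val_inj.
- by rewrite cE inE => /eqP/= h; apply: Or41; exists i; apply: val_inj.
- by rewrite sE inE => /eqP/= h; apply: Or43; exists i; rewrite -h PoszD.
- by rewrite tE inE => /eqP/= h; apply: Or44; exists i.
Qed.

(** * Counting diagonals by position *)

(** Windows are half-open so that adjacent ones split a window without overlap. *)
Definition hits p (u : 'I_p -> int) (lo hi : int) : nat :=
  #|[set i | (lo <= u i < hi)%R]|.

Lemma hits_le p (u : 'I_p -> int) lo hi : hits u lo hi <= p.
Proof. by rewrite -[leqRHS]card_ord max_card. Qed.

Lemma hits_split p (u : 'I_p -> int) (lo mid hi : int) :
  (lo <= mid)%R -> (mid <= hi)%R ->
  hits u lo hi = hits u lo mid + hits u mid hi.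
Proof.
move=> lm mh; rewrite /hits -(cardsID [set i | (u i < mid)%R]).
by congr (_ + _); apply: eq_card => i; rewrite !inE; lia.
Qed.

Lemma card_le_hits (T : finType) p (A : {set T}) (f : T -> int)
    (u : 'I_p -> int) (lo hi : int) :
  injective f ->
  (forall x, x \in A -> (lo <= f x < hi)%R /\ exists i, f x = u i) ->
  #|A| <= hits u lo hi.
Proof.
move=> inj_f fA; rewrite /hits !cardE -(size_map f) -(size_map u).
apply: uniq_leq_size => [|v /mapP[x]]; first by rewrite map_inj_uniq ?enum_uniq.
rewrite mem_enum => xA ->; have [fx [i fi]] := fA x xA.
by rewrite fi; apply: map_f; rewrite mem_enum inE -fi.
Qed.

(** A line meets every diagonal at most once, so the cells of a line that are
    covered diagonally cost one diagonal each; [f1] and [f2] are to be the two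
    diagonal coordinates along that line. *)
Lemma card_le_hits2 (T : finType) p (A : {set T}) (f1 f2 : T -> int)
    (u1 u2 : 'I_p -> int) (lo1 hi1 lo2 hi2 : int) :
  injective f1 -> injective f2 ->
  (forall x, x \in A -> (exists i, f1 x = u1 i) \/ (exists i, f2 x = u2 i)) ->
  (forall x, x \in A -> (lo1 <= f1 x < hi1)%R && (lo2 <= f2 x < hi2)%R) ->
  #|A| <= hits u1 lo1 hi1 + hits u2 lo2 hi2.
Proof.
move=> inj1 inj2 cov rng; rewrite -(cardsID [set x | [exists i, f1 x == u1 i]]).
apply: leq_add; [apply: (card_le_hits inj1) => x | apply: (card_le_hits inj2) => x];
  rewrite !inE.
  case/andP=> xA /existsP[i /eqP fi]; have /andP[? _] := rng x xA.
  by split=> //; exists i.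
case/andP=> /existsPn no1 xA; have /andP[_ ?] := rng x xA; split=> //.
by case: (cov x xA) => [[i fi]|//]; have := no1 i; rewrite fi eqxx.
Qed.

(** * Rows and columns that are not chosen *)

Definition free n p (l : 'I_p -> 'I_n) : {set 'I_n} :=
  ~: [set l i | i : 'I_p].

Lemma free_neq n p (l : 'I_p -> 'I_n) x i : x \in free l -> l i <> x.
Proof. by rewrite inE => /negP xl lx; apply: xl; rewrite -lx imset_f. Qed.

Lemma card_free n p (l : 'I_p -> 'I_n) : n <= #|free l| + p.
Proof.
rewrite -[leqLHS](card_ord n) -(cardsC [set l i | i : 'I_p]) addnC leq_add2l.
by rewrite -[leqRHS](card_ord p) leq_imset_card.
Qed.

Definition extremes n (A : {set 'I_n}) (lo hi : 'I_n) : Prop :=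
  [/\ lo \in A, hi \in A & forall x, x \in A -> lo <= x <= hi].

Lemma ex_extremes n (A : {set 'I_n}) :
  0 < #|A| -> exists lo hi, extremes A lo hi.
Proof.
case/card_gt0P=> x0 Ax0.
have [lo Alo lo_min] := arg_minnP (fun i : 'I_n => i : nat) Ax0.
have [hi Ahi hi_max] := arg_maxnP (fun i : 'I_n => i : nat) Ax0.
by exists lo, hi; split=> // x xA; rewrite lo_min //=; exact: hi_max.
Qed.

Lemma extremes_lt n (A : {set 'I_n}) lo hi :
  extremes A lo hi -> 1 < #|A| -> lo < hi.
Proof.
case=> loA hiA bnd; rewrite (cardsD1 lo) loA => /card_gt0P[x].
by rewrite !inE -val_eqE => /andP[/= xlo /bnd]; lia.
Qed.

Lemma card_inner n (A : {set 'I_n}) (lo hi : 'I_n) :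
  #|A| <= #|A :\ lo :\ hi| + 2.
Proof.
rewrite (cardsD1 lo) (cardsD1 hi (A :\ lo)) addnA addnC leq_add2l.
by do 2 case: (_ \in _).
Qed.

Lemma inner_bounds n (A : {set 'I_n}) (lo hi x : 'I_n) :
  extremes A lo hi -> x \in A :\ lo :\ hi -> lo < x < hi.
Proof.
case=> _ _ bnd; rewrite !inE -!val_eqE /= => /and3P[xhi xlo /bnd]; lia.
Qed.

(** * The lower bound *)

Section FreeBox.

Variables (n p : nat) (r c : 'I_p -> 'I_n) (s t : 'I_p -> int).
Hypothesis cov : covers r c s t.

Local Notation X := (free c).
Local Notation Y := (free r).

Lemma free_cell_on_diagonal x y : x \in X -> y \in Y ->
  (exists i, (x%:Z + y%:Z)%R = s i) \/ (exists i, (x%:Z - y%:Z)%R = t i).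
Proof.
move=> xX yY; case: (cov x y) => [[i]|[i]|?|?]; [| |by left|by right].
  by move/(free_neq xX).
by move/(free_neq yY).
Qed.

Lemma column_hits (x : 'I_n) (A : {set 'I_n}) (lo hi : int) :
  x \in X -> A \subset Y ->
  (forall y : 'I_n, y \in A -> (lo <= y%:Z < hi)%R) ->
  #|A| <= hits s (x%:Z + lo)%R (x%:Z + hi)%R
          + hits t (x%:Z - hi + 1)%R (x%:Z - lo + 1)%R.
Proof.
move=> xX /subsetP AY rng.
apply: (card_le_hits2 (f1 := fun y : 'I_n => (x%:Z + y%:Z)%R)
                      (f2 := fun y : 'I_n => (x%:Z - y%:Z)%R)).
- by move=> y y' e; apply: val_inj => /=; lia.
- by move=> y y' e; apply: val_inj => /=; lia.
- by move=> y /AY; exact: free_cell_on_diagonal.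
- by move=> y /rng; lia.
Qed.

Lemma row_hits (y : 'I_n) (A : {set 'I_n}) (lo hi : int) :
  y \in Y -> A \subset X ->
  (forall x : 'I_n, x \in A -> (lo <= x%:Z < hi)%R) ->
  #|A| <= hits s (y%:Z + lo)%R (y%:Z + hi)%R
          + hits t (lo - y%:Z)%R (hi - y%:Z)%R.
Proof.
move=> yY /subsetP AX rng.
apply: (card_le_hits2 (f1 := fun x : 'I_n => (x%:Z + y%:Z)%R)
                      (f2 := fun x : 'I_n => (x%:Z - y%:Z)%R)).
- by move=> x x' e; apply: val_inj => /=; lia.
- by move=> x x' e; apply: val_inj => /=; lia.
- by move=> x /AX xX; exact: free_cell_on_diagonal.
- by move=> x /rng; lia.
Qed.

Variables (a b lo hi : 'I_n).
Hypotheses (exX : extremes X a b) (exY : extremes Y lo hi).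

(** In a wider box the windows of diagonals that meet column [a] and of those
    that meet column [b] are disjoint, so the two counts add up to at most [p]
    in each direction. *)
Lemma column_gap_le : 2 * p < n -> b - a <= hi - lo.
Proof.
move=> pn; rewrite leqNgt; apply/negP => gap.
have [aX bX Xbnd] := exX; have [loY hiY Ybnd] := exY.
have rng (y : 'I_n) : y \in Y -> (lo%:Z <= y%:Z < hi%:Z + 1)%R.
  by move/Ybnd; lia.
have Ha := column_hits aX (subxx _) rng; have Hb := column_hits bX (subxx _) rng.
have ab := Xbnd _ aX; have lh := Ybnd _ loY.
have := hits_le s (a%:Z + lo%:Z)%R (b%:Z + (hi%:Z + 1))%R.
have := hits_le t (a%:Z - (hi%:Z + 1) + 1)%R (b%:Z - lo%:Z + 1)%R.
rewrite (@hits_split _ s _ (a%:Z + (hi%:Z + 1))%R); [|lia|lia].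
rewrite (@hits_split _ s (a%:Z + (hi%:Z + 1))%R (b%:Z + lo%:Z)%R); [|lia|lia].
rewrite (@hits_split _ t _ (a%:Z - lo%:Z + 1)%R); [|lia|lia].
rewrite (@hits_split _ t (a%:Z - lo%:Z + 1)%R (b%:Z - (hi%:Z + 1) + 1)%R); [|lia|lia].
by have := card_free r; lia.
Qed.

Lemma row_gap_le : 2 * p < n -> hi - lo <= b - a.
Proof.
move=> pn; rewrite leqNgt; apply/negP => gap.
have [aX bX Xbnd] := exX; have [loY hiY Ybnd] := exY.
have rng (x : 'I_n) : x \in X -> (a%:Z <= x%:Z < b%:Z + 1)%R.
  by move/Xbnd; lia.
have Hl := row_hits loY (subxx _) rng; have Hh := row_hits hiY (subxx _) rng.
have ab := Xbnd _ aX; have lh := Ybnd _ loY.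
have := hits_le s (lo%:Z + a%:Z)%R (hi%:Z + (b%:Z + 1))%R.
have := hits_le t (a%:Z - hi%:Z)%R (b%:Z + 1 - lo%:Z)%R.
rewrite (@hits_split _ s _ (lo%:Z + (b%:Z + 1))%R); [|lia|lia].
rewrite (@hits_split _ s (lo%:Z + (b%:Z + 1))%R (hi%:Z + a%:Z)%R); [|lia|lia].
rewrite (@hits_split _ t _ (b%:Z + 1 - hi%:Z)%R); [|lia|lia].
rewrite (@hits_split _ t (b%:Z + 1 - hi%:Z)%R (a%:Z - lo%:Z)%R); [|lia|lia].
by have := card_free c; lia.
Qed.

(** The diagonals of each direction are cut into five classes by the corners of
    the box: through the first corner, before the centre, through the centre,
    after the centre, through the last corner. The four sides and the four
    corners bound sums of class sizes from below; the totals bound them from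
    above, and the parity of the inner side length makes this inconsistent. *)
Lemma square_box_absurd k :
  n = 4 * k + 1 -> p <= 2 * k -> b - a = hi - lo -> False.
Proof.
move=> nk pk sq.
have cX := card_free c; have cY := card_free r.
have [aX bX Xbnd] := exX; have [loY hiY Ybnd] := exY.
have ab := Xbnd _ aX; have lh := Ybnd _ loY.
have corner (x y : 'I_n) : x \in X -> y \in Y ->
    0 < hits s (x%:Z + y%:Z)%R (x%:Z + y%:Z + 1)%R
        + hits t (x%:Z - y%:Z)%R (x%:Z - y%:Z + 1)%R.
  move=> xX yY.
  have sub : [set y] \subset Y by rewrite sub1set.
  have rng (y' : 'I_n) : y' \in [set y] -> (y%:Z <= y'%:Z < y%:Z + 1)%R.
    by rewrite inE => /eqP ->; lia.
  have := column_hits xX sub rng; rewrite cards1.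
  have -> : (x%:Z + (y%:Z + 1) = x%:Z + y%:Z + 1)%R by lia.
  by have -> : (x%:Z - (y%:Z + 1) + 1 = x%:Z - y%:Z)%R by lia.
have c1 := corner _ _ aX loY; have c2 := corner _ _ aX hiY.
have c3 := corner _ _ bX loY; have c4 := corner _ _ bX hiY.
(* The box is not a single cell: that would force [p = 0], and then not even a
   corner is covered. *)
have p_gt0 : 0 < p.
  by have := hits_le s (a%:Z + lo%:Z)%R (a%:Z + lo%:Z + 1)%R;
     have := hits_le t (a%:Z - lo%:Z)%R (a%:Z - lo%:Z + 1)%R; lia.
have ltab : a < b by apply: (extremes_lt exX); lia.
have ltlh : lo < hi by apply: (extremes_lt exY); lia.
have iX := card_inner X a b; have iY := card_inner Y lo hi.
have subX : X :\ a :\ b \subset X by do 2 apply: (subset_trans (subD1set _ _)).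
have subY : Y :\ lo :\ hi \subset Y by do 2 apply: (subset_trans (subD1set _ _)).
have rngX (x : 'I_n) : x \in X :\ a :\ b -> (a%:Z + 1 <= x%:Z < b%:Z)%R.
  by move/(inner_bounds exX); lia.
have rngY (y : 'I_n) : y \in Y :\ lo :\ hi -> (lo%:Z + 1 <= y%:Z < hi%:Z)%R.
  by move/(inner_bounds exY); lia.
have left := column_hits aX subY rngY; have right := column_hits bX subY rngY.
have bottom := row_hits loY subX rngX; have top := row_hits hiY subX rngX.
have totS := hits_le s (a%:Z + lo%:Z)%R (b%:Z + hi%:Z + 1)%R.
have totT := hits_le t (a%:Z - hi%:Z)%R (b%:Z - lo%:Z + 1)%R.
rewrite (@hits_split _ s _ (a%:Z + lo%:Z + 1)%R) in totS; [|lia|lia].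
rewrite (@hits_split _ s (a%:Z + lo%:Z + 1)%R (a%:Z + hi%:Z)%R) in totS; [|lia|lia].
rewrite (@hits_split _ s (a%:Z + hi%:Z)%R (a%:Z + hi%:Z + 1)%R) in totS; [|lia|lia].
rewrite (@hits_split _ s (a%:Z + hi%:Z + 1)%R (b%:Z + hi%:Z)%R) in totS; [|lia|lia].
rewrite (@hits_split _ t _ (a%:Z - hi%:Z + 1)%R) in totT; [|lia|lia].
rewrite (@hits_split _ t (a%:Z - hi%:Z + 1)%R (a%:Z - lo%:Z)%R) in totT; [|lia|lia].
rewrite (@hits_split _ t (a%:Z - lo%:Z)%R (a%:Z - lo%:Z + 1)%R) in totT; [|lia|lia].
rewrite (@hits_split _ t (a%:Z - lo%:Z + 1)%R (b%:Z - lo%:Z)%R) in totT; [|lia|lia].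
(* By squareness the ends of each main diagonal of the box agree in [x + y] or
   in [x - y] ([e1], [e2]), so the windows of opposite sides and corners match
   those into which the totals are split. *)
have e1 : (b%:Z + lo%:Z = a%:Z + hi%:Z)%R by lia.
have e2 : (b%:Z - hi%:Z = a%:Z - lo%:Z)%R by lia.
have l1 : (a%:Z + (lo%:Z + 1) = a%:Z + lo%:Z + 1)%R by lia.
have l2 : (a%:Z - (lo%:Z + 1) + 1 = a%:Z - lo%:Z)%R by lia.
have r1 : (b%:Z + (lo%:Z + 1) = a%:Z + hi%:Z + 1)%R by lia.
have r2 : (b%:Z - (lo%:Z + 1) + 1 = b%:Z - lo%:Z)%R by lia.
have b1 : (lo%:Z + (a%:Z + 1) = a%:Z + lo%:Z + 1)%R by lia.
have b2 : (lo%:Z + b%:Z = a%:Z + hi%:Z)%R by lia.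
have b3 : (a%:Z + 1 - lo%:Z = a%:Z - lo%:Z + 1)%R by lia.
have t1 : (hi%:Z + (a%:Z + 1) = a%:Z + hi%:Z + 1)%R by lia.
have t2 : (hi%:Z + b%:Z = b%:Z + hi%:Z)%R by lia.
have t3 : (a%:Z + 1 - hi%:Z = a%:Z - hi%:Z + 1)%R by lia.
rewrite l1 l2 in left; rewrite r1 r2 e2 in right.
rewrite b1 b2 b3 in bottom; rewrite t1 t2 t3 e2 in top.
rewrite e1 in c3; rewrite e2 in c4.
clear e1 e2 l1 l2 r1 r2 b1 b2 b3 t1 t2 t3.
lia.
Qed.

End FreeBox.

Lemma covers_lower_bound n p k (r c : 'I_p -> 'I_n) (s t : 'I_p -> int) :
  covers r c s t -> n = 4 * k + 1 -> 2 * k < p.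
Proof.
move=> cov nk; rewrite ltnNge; apply/negP => pk.
have [] := @ex_extremes _ (free c); first by have := card_free c; lia.
move=> a [b exX].
have [] := @ex_extremes _ (free r); first by have := card_free r; lia.
move=> lo [hi exY].
have pn : 2 * p < n by lia.
apply: (square_box_absurd cov exX exY nk pk).
by apply/eqP; rewrite eqn_leq (column_gap_le cov exX exY pn) (row_gap_le cov exX exY pn).
Qed.

Theorem theorem3p2 (n : nat) (hn : 0 < n)
  (hk : exists k : int, (n%:Z = 4 * k + 1)%R) :
  queen_beta n <= queen_gamma n /\
  ((n%:R + 1) / 2 <= (queen_beta n)%:R :> rat)%R.
Proof.
split; first exact: queen_beta_le_gamma.
have [k nk] : exists k, n = 4 * k + 1.
  by case: hk => k nk; exists `|k|%N; lia.
have : 2 * k < queen_beta n.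
  rewrite /queen_beta; case: ex_minnP => p /line_coverable_covers[r [c [s [t cov]]]] _.
  exact: covers_lower_bound cov nk.
rewrite ler_pdivrMr ?ltr0n // natr1 -natrM ler_nat; lia.
Qed.
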